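(* Let $a,b\in\mathbb{R}^2$ be linearly independent over $\mathbb{R}$, let $\nu=ra+sb$, and suppose that $r,s\in\mathbb{Q}$. Then the set $\Lambda=\{0,a,b,\nu\}\subset\mathbb{R}^2$ is contained in a full-rank lattice of $\mathbb{R}^2$ that is finer than $L_0=\mathbb{Z}a+\mathbb{Z}b$. Consequently, for every nonzero $f\in L^2(\mathbb{R})$, the family $\{\pi(\lambda)f:\lambda\in\Lambda\}$, indexed by the elements of the set $\Lambda$, is linearly independent over $\mathbb{C}$.
   Context: $L^2(\mathbb{R})$ is the complex Hilbert space of (classes of) square-integrable functions $\mathbb{R}\to\mathbb{C}$ with respect to Lebesgue measure. For $x,\omega\in\mathbb{R}$ define operators on $L^2(\mathbb{R})$ by $T_xf(t)=f(t-x)$, $M_\omega f(t)=e^{2\pi i\omega t}f(t)$, and the time-frequency shift $\pi(x,\omega)=M_\omega T_x$. For $z=(x,\omega)\in\mathbb{R}^2$ write $\pi(z)=\pi(x,\omega)$. A full-rank lattice in $\mathbb{R}^2$ is a subgroup of the form $\mathbb{Z}u+\mathbb{Z}v$ with $u,v\in\mathbb{R}^2$ linearly independent over $\mathbb{R}$; a lattice is finer than $L_0$ if it contains $L_0$ (equality allowed). The set $\Lambda$ is a set of distinct points: if $\nu$ coincides with one of $0,a,b$, it is counted only once. *)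

(* Defs.v *)
From HB Require Import structures.
From mathcomp Require Import all_boot all_order all_algebra.
From mathcomp Require Import generic_quotient ring_quotient.
From mathcomp Require Import all_classical all_reals all_analysis.
From mathcomp Require Import measurable_realfun complex.
From mathcomp Require Import ring.

Set Implicit Arguments.
Unset Strict Implicit.
Unset Printing Implicit Defensive.

Import Order.TTheory GRing.Theory Num.Theory.
Import numFieldNormedType.Exports.

Local Open Scope classical_set_scope.
Local Open Scope ring_scope.
Local Open Scope complex_scope.
Local Open Scope quotient_scope.

Section square_integrable.
Context (R : realType).
Local Notation mu := (@lebesgue_measure R).
Implicit Types f g : R -> R[i].

(* Measurability is with respect to the Borel sigma-algebra: modulo null sets
   this gives the same classes as Lebesgue measurability. *)
Definition sqr_integrable f : Prop :=
  [/\ measurable_fun setT (fun t => complex.Re (f t)),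
      measurable_fun setT (fun t => complex.Im (f t)) &
      (\int[mu]_t (Normc.normc (f t) ^+ 2)%:E < +oo)%E].

Lemma sqr_normc (z : R[i]) :
  Normc.normc z ^+ 2 = complex.Re z ^+ 2 + complex.Im z ^+ 2.
Proof. by case: z => x y /=; rewrite sqr_sqrtr// addr_ge0// sqr_ge0. Qed.

Lemma measurable_sqr_normc f :
  measurable_fun setT (fun t => complex.Re (f t)) ->
  measurable_fun setT (fun t => complex.Im (f t)) ->
  measurable_fun setT (fun t => (Normc.normc (f t) ^+ 2)%:E : \bar R).
Proof.
move=> mr mi; apply/measurable_EFinP.
under eq_fun do rewrite sqr_normc.
by apply: measurable_funD; apply: measurable_funX.
Qed.

Definition sqr_integrable_pred : {pred R -> R[i]} :=
  fun f => `[< sqr_integrable f >].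

Lemma sqr_integrable_submod_closed : submod_closed sqr_integrable_pred.
Proof.
split.
  apply/asboolP; split; [exact: measurable_cst|exact: measurable_cst|].
  rewrite integral0_eq ?ltry// => t _.
  by rewrite sqr_normc /= expr0n addr0.
move=> a f g /asboolP[fr fi fF] /asboolP[gr gi gF]; apply/asboolP.
have er t : complex.Re ((a *: f + g) t) =
    complex.Re a * complex.Re (f t) - complex.Im a * complex.Im (f t)
    + complex.Re (g t).
  rewrite [(_ + _) t]/(a * f t + g t).
  by case: (a) (f t) (g t) => [? ?] [? ?] [? ?].
have ei t : complex.Im ((a *: f + g) t) =
    complex.Re a * complex.Im (f t) + complex.Im a * complex.Re (f t)
    + complex.Im (g t).
  rewrite [(_ + _) t]/(a * f t + g t).
  by case: (a) (f t) (g t) => [? ?] [? ?] [? ?].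
have mr : measurable_fun setT (fun t => complex.Re ((a *: f + g) t)).
  under eq_fun do rewrite er.
  apply: measurable_funD => //; apply: measurable_funB;
    by apply: measurable_funM => //; exact: measurable_cst.
have mi : measurable_fun setT (fun t => complex.Im ((a *: f + g) t)).
  under eq_fun do rewrite ei.
  apply: measurable_funD => //; apply: measurable_funD;
    by apply: measurable_funM => //; exact: measurable_cst.
split=> //.
pose C := 2 * Normc.normc a ^+ 2.
have C0 : 0 <= C by rewrite mulr_ge0// sqr_ge0.
have mf := measurable_sqr_normc fr fi.
have mg := measurable_sqr_normc gr gi.
apply: (@le_lt_trans _ _ (\int[mu]_t (C%:E * (Normc.normc (f t) ^+ 2)%:E
   + 2%:E * (Normc.normc (g t) ^+ 2)%:E))%E).
  apply: ge0_le_integral => //.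
  - by move=> t _; rewrite lee_fin sqr_ge0.
  - exact: measurable_sqr_normc.
  - by apply: emeasurable_funD; apply: measurable_funeM.
  - move=> t _; rewrite -!EFinM -EFinD lee_fin sqr_normc er ei /C !sqr_normc.
    move: (complex.Re a) (complex.Im a) (complex.Re (f t)) (complex.Im (f t))
      (complex.Re (g t)) (complex.Im (g t)) => p q u v x y.
    rewrite -subr_ge0.
    rewrite [X in 0 <= X](_ : _ = (p * u - q * v - x) ^+ 2
      + (p * v + q * u - y) ^+ 2); last by ring.
    by rewrite addr_ge0// sqr_ge0.
rewrite ge0_integralD//=; last 4 first.
- by move=> t _; rewrite mule_ge0 ?lee_fin ?sqr_ge0.
- exact: measurable_funeM.
- by move=> t _; rewrite mule_ge0 ?lee_fin ?sqr_ge0.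
- exact: measurable_funeM.
rewrite !ge0_integralZl ?lee_fin//;
  try by move=> t _; rewrite lee_fin sqr_ge0.
by rewrite lte_add_pinfty// lte_mul_pinfty.
Qed.

HB.instance Definition _ := GRing.isSubmodClosed.Build R[i] (R -> R[i])
  sqr_integrable_pred sqr_integrable_submod_closed.

Record L2fun := MkL2fun {
  L2val :> R -> R[i];
  _ : L2val \in sqr_integrable_pred }.

HB.instance Definition _ := [isSub for L2val].
HB.instance Definition _ := [Choice of L2fun by <:].
HB.instance Definition _ := [SubChoice_isSubLmodule of L2fun by <:].

Definition null_fun : {pred L2fun} :=
  fun f : L2fun => `[< {ae mu, forall t, f t = 0} >].

Lemma null_fun_submod_closed : submod_closed null_fun.
Proof.
split; first by apply/asboolP; exact/aeW.
move=> a f g /asboolP f0 /asboolP g0; apply/asboolP.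
apply: (@filterS2 _ _ (ae_filter_ringOfSetsType mu)) f0 g0 => t ft gt.
by change (a *: f t + g t = 0); rewrite ft gt scaler0 addr0.
Qed.

HB.instance Definition _ := GRing.isSubmodClosed.Build R[i] L2fun
  null_fun null_fun_submod_closed.

(* L^2(R; C) as a complex vector space: square-integrable functions modulo
   almost everywhere equality (see L2_eqP). *)
Definition L2 : Type := Quotient.quot null_fun.

HB.instance Definition _ := GRing.Zmodule.on L2.
HB.instance Definition _ := EqQuotient.on L2.

Lemma L2_eqP (f g : L2fun) :
  reflect {ae mu, forall t, f t = g t} (\pi_L2 f == \pi_L2 g).
Proof.
rewrite -[_ == _]/(\pi_(Quotient.quot null_fun) f == \pi g) -Quotient.idealrBE.
apply: (iffP (asboolP _));
  apply: (@filterS _ _ (ae_filter_ringOfSetsType mu)) => t.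
  by rewrite [X in X = _]/(f t - g t) => /subr0_eq.
by move=> e; rewrite [LHS]/(f t - g t) e; exact: subrr.
Qed.

Definition L2_scale (c : R[i]) (u : L2) : L2 := \pi_L2 (c *: repr u).

Lemma ae_repr (f : L2fun) : {ae mu, forall t, repr (\pi_L2 f) t = f t}.
Proof. by apply/L2_eqP; rewrite reprK. Qed.

Lemma pi_L2_scale c (f : L2fun) : \pi_L2 (c *: f) = L2_scale c (\pi f).
Proof.
apply/eqP/L2_eqP.
apply: (@filterS _ _ (ae_filter_ringOfSetsType mu)) (ae_repr f) => t e.
by rewrite [LHS]/(c *: f t) [RHS]/(c *: repr (\pi_L2 f) t) e.
Qed.

Lemma pi_L2D (f g : L2fun) : \pi_L2 (f + g) = \pi f + \pi g.
Proof. exact: (@Quotient.pi_add _ null_fun). Qed.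

Lemma L2_scaleA c d u : L2_scale c (L2_scale d u) = L2_scale (c * d) u.
Proof.
elim/quotW: u => f.
by rewrite -(pi_L2_scale d f) -(pi_L2_scale c) -(pi_L2_scale _ f) scalerA.
Qed.

Lemma L2_scale1 : left_id 1 L2_scale.
Proof. by elim/quotW => f; rewrite -(pi_L2_scale 1 f) scale1r. Qed.

Lemma L2_scaleDr : right_distributive L2_scale +%R.
Proof.
move=> c; elim/quotW => f; elim/quotW => g.
rewrite -(pi_L2D f g) -(pi_L2_scale c (f + g)) -(pi_L2_scale c f).
by rewrite -(pi_L2_scale c g) -pi_L2D scalerDr.
Qed.

Lemma L2_scaleDl u : {morph L2_scale^~ u : c d / c + d}.
Proof.
elim/quotW: u => f c d /=; rewrite -(pi_L2_scale (c + d) f).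
by rewrite -(pi_L2_scale c f) -(pi_L2_scale d f) -pi_L2D scalerDl.
Qed.

HB.instance Definition _ := GRing.Zmodule_isLmodule.Build R[i] L2
  L2_scaleA L2_scale1 L2_scaleDr L2_scaleDl.

Lemma pi_L2Z c (f : L2fun) : \pi_L2 (c *: f) = c *: \pi_L2 f.
Proof. exact: pi_L2_scale. Qed.

End square_integrable.

Section time_frequency_shifts.
Context (R : realType).
Local Notation mu := (@lebesgue_measure R).
Implicit Types (x w t : R) (f g : L2fun R).

(* exp(it) *)
Definition cis t : R[i] := cos t +i* sin t.

Let sub_mf x (t : R) : measurableTypeR R := t - x.

Let measurable_sub x : measurable_fun setT (sub_mf x).
Proof. by apply: measurable_funB => //; exact: measurable_cst. Qed.

Lemma lebesgue_measure_sub x (A : set (measurableTypeR R)) : measurable A ->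
  pushforward mu (sub_mf x) A = mu A.
Proof.
have mx := measurable_sub x.
move=> mA; apply/esym/lebesgue_measure_unique => //= _ [[a b]] _ <-.
rewrite /pushforward.
rewrite (_ : sub_mf x @^-1` _ = `]a + x, b + x]%classic); last first.
  by apply/seteqP; split=> t /=; rewrite !in_itv/= /sub_mf ltrBrDr lerBlDr.
rewrite !lebesgue_measure_itv/= !lte_fin ltrD2r.
by rewrite -!EFinB opprD addrACA subrr addr0.
Qed.

Lemma ae_sub x (P : R -> Prop) :
  {ae mu, forall t, P t} -> {ae mu, forall t, P (t - x)}.
Proof.
move=> [A [mA A0 PA]]; exists (sub_mf x @^-1` A); split.
- by rewrite -[X in measurable X]setTI; exact: measurable_sub.
- by apply: etrans A0; exact: lebesgue_measure_sub.
- by move=> t /= Pt; exact: PA.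
Qed.

Lemma translation_subproof x f :
  (fun t => f (t - x)) \in @sqr_integrable_pred R.
Proof.
have /asboolP[mr mi fF] := valP f; apply/asboolP; split.
- exact: (measurableT_comp mr (measurable_sub x)).
- exact: (measurableT_comp mi (measurable_sub x)).
- have mx := measurable_sub x.
  have pushE : (\int[pushforward mu (sub_mf x)]_t (Normc.normc (f t) ^+ 2)%:E
      < +oo)%E.
    apply: le_lt_trans fF; rewrite le_eqVlt; apply/orP; left; apply/eqP.
    by apply: eq_measure_integral => // A mA _; exact: lebesgue_measure_sub.
  rewrite ge0_integral_pushforward// in pushE.
  + exact: measurable_sqr_normc.
  + by move=> t _; rewrite lee_fin sqr_ge0.
Qed.

Definition translation_fun x f : L2fun R := MkL2fun (translation_subproof x f).

Lemma modulation_subproof w f :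
  (fun t => cis (2 * pi * w * t) * f t) \in @sqr_integrable_pred R.
Proof.
have /asboolP[mr mi fF] := valP f.
have mt : measurable_fun [set: R] (fun t => 2 * pi * w * t).
  by apply: measurable_funM => //; exact: measurable_cst.
have mc : measurable_fun [set: R] (fun t => cos (2 * pi * w * t)).
  by apply: measurableT_comp mt; apply: continuous_measurable_fun; exact: continuous_cos.
have ms : measurable_fun [set: R] (fun t => sin (2 * pi * w * t)).
  by apply: measurableT_comp mt; apply: continuous_measurable_fun; exact: continuous_sin.
apply/asboolP; split.
- rewrite (_ : (fun t => _) = fun t => cos (2 * pi * w * t) * complex.Re (f t)
    - sin (2 * pi * w * t) * complex.Im (f t)).
    by apply: measurable_funB; exact: measurable_funM.
  by apply/funext => t; case: (f t).
- rewrite (_ : (fun t => _) = fun t => cos (2 * pi * w * t) * complex.Im (f t)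
    + sin (2 * pi * w * t) * complex.Re (f t)).
    by apply: measurable_funD; exact: measurable_funM.
  by apply/funext => t; case: (f t).
- apply: le_lt_trans fF; rewrite le_eqVlt; apply/orP; left; apply/eqP.
  apply: eq_integral => t _.
  by rewrite Normc.normcM /= cos2Dsin2 sqrtr1 mul1r.
Qed.

Definition modulation_fun w f : L2fun R := MkL2fun (modulation_subproof w f).

(* Both operators are computed on an arbitrary representative; translation_pi
   and modulation_pi state that the result does not depend on it. *)
Definition translation x (u : L2 R) : L2 R :=
  \pi_(L2 R) (translation_fun x (repr u)).

Definition modulation w (u : L2 R) : L2 R :=
  \pi_(L2 R) (modulation_fun w (repr u)).

Lemma translation_pi x f :
  translation x (\pi_(L2 R) f) = \pi_(L2 R) (translation_fun x f).
Proof. by apply/eqP/L2_eqP; exact: ae_sub (ae_repr f). Qed.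

Lemma modulation_pi w f :
  modulation w (\pi_(L2 R) f) = \pi_(L2 R) (modulation_fun w f).
Proof.
apply/eqP/L2_eqP.
by apply: (@filterS _ _ (ae_filter_ringOfSetsType mu)) (ae_repr f) => t /= ->.
Qed.

(* For z = (x, w), seen as a row vector, this is pi(z) = M_w T_x. *)
Definition tfshift (z : 'rV[R]_2) (u : L2 R) : L2 R :=
  modulation (z 0 1) (translation (z 0 0) u).

End time_frequency_shifts.

Section lattices.
Context (R : realType).

Definition zspan (u v : 'rV[R]_2) : set 'rV[R]_2 :=
  [set z | exists m n : int, z = u *~ m + v *~ n].

Definition full_rank_lattice (L : set 'rV[R]_2) : Prop :=
  exists u v, free [:: u; v] /\ L = zspan u v.

End lattices.

(* Linear independence of the possibly infinite family (v i), i in A: every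
   vanishing linear combination of finitely many of its members is trivial.
   The family is indexed, so repeated vectors make it dependent. *)
Definition lin_indep (K : fieldType) (V : lmodType K) (I : eqType)
    (A : set I) (v : I -> V) : Prop :=
  forall (s : seq I) (c : I -> K), uniq s -> [set` s] `<=` A ->
    \sum_(i <- s) c i *: v i = 0 -> forall i, i \in s -> c i = 0.

(* Main.v *)
Require Import Defs.
From HB Require Import structures.
From mathcomp Require Import all_boot all_order all_algebra.
From mathcomp Require Import all_classical all_reals all_analysis.
From mathcomp Require Import complex.
From mathcomp Require Import measurable_realfun ring lra zify.

(* Choose a basis u, v of a lattice containing the points, with u not vertical.
   Multiplying f by a chirp shears the time-frequency plane, so u becomes a pure
   translation by p > 0 and v a shift of frequency q <> 0.  A dependence says
   that f satisfies one twisted convolution equation on Z^2, the same for all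
   its lattice shifts.  For Q in an N x N box let h_Q be the lattice shift by Q
   of the functional sampling f at J points of step 1/(qN), starting at x.  The
   matrix G(P,Q) = h_Q (pi(P)^-1 f) has constant diagonal, the sum of the J
   samples.  Solving the equation for the extremal lattice point expresses every
   interior row through later rows, so G has rank O(N), and
   |tr G|^2 <= rank G * sum |G(P,Q)|^2.  When x is integrated over a period of
   length p, translation invariance and Parseval for the discrete Fourier
   transform of order N bound the integral of the last sum by J N^3 |f|^2.
   So the sum of the J samples has squared L^2 norm O(J) on every period,
   uniformly in N >= J.  Letting N tend to infinity the samples collapse to one
   point and the sum becomes J times f, of squared norm of order J^2: f = 0. *)

Set Implicit Arguments.
Unset Strict Implicit.
Unset Printing Implicit Defensive.

Import Order.TTheory GRing.Theory Num.Theory.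
Import numFieldNormedType.Exports.

Local Open Scope ring_scope.

(** * Trace, rank and twisted convolution on Z^2 *)

Section trace_bounds.
Local Open Scope sesquilinear_scope.

(** With [X] the first factor, [Y] the second and [S] the sum, expanding the nonnegative sum of the
    [|X y_i - S conj(x_i)|^2] gives [X (X Y - |S|^2)]; it remains to divide by [X], unless [X = 0]
    and all [x_i] vanish. *)
Lemma CauchySchwarz_sum (C : numClosedFieldType) (I : finType) (x y : I -> C) :
  `|\sum_i x i * y i| ^+ 2 <= (\sum_i `|x i| ^+ 2) * (\sum_i `|y i| ^+ 2).
Proof.
set X := \sum_i `|x i| ^+ 2; set Y := \sum_i `|y i| ^+ 2.
have sq0 (z : C) : 0 <= `|z| ^+ 2 by rewrite exprn_ge0.
have X0 : 0 <= X by apply: sumr_ge0.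
have [X00|Xn0] := eqVneq X 0.
  rewrite X00 mul0r big1 ?normr0 ?expr0n// => i _.
  have /eqP := psumr_eq0P (fun i _ => sq0 (x i)) X00 isT (i := i).
  by rewrite expf_eq0 /= normr_eq0 => /eqP ->; rewrite mul0r.
set S := \sum_i x i * y i.
have Xp : 0 < X by rewrite lt0r Xn0.
have : 0 <= \sum_i `|X * y i - S * (x i)^*| ^+ 2 by apply: sumr_ge0.
have -> : \sum_i `|X * y i - S * (x i)^*| ^+ 2 = X * (X * Y - `|S| ^+ 2).
  transitivity (\sum_i (X ^+ 2 * `|y i| ^+ 2 - X * S^* * (x i * y i)
      - X * S * (x i * y i)^* + `|S| ^+ 2 * `|x i| ^+ 2)).
    apply: eq_bigr => i _.
    by rewrite !normCK !(rmorphB, rmorphM) /= conjCK (geC0_conj X0); ring.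
  rewrite big_split !sumrB /= -!mulr_sumr -rmorph_sum -/S -/X -/Y normCK.
  by ring.
by rewrite pmulr_rge0// subr_ge0.
Qed.

(** Factor [G = A B] through the rank, with the rows of [B] orthonormal. Then [A] has the
    Hilbert-Schmidt norm of [G], that of [B] squared is the rank, and Cauchy-Schwarz applies to the
    trace seen as a pairing of the entries of [A] and [B]. *)
Lemma normC_trace_le_rank (C : numClosedFieldType) n (G : 'M[C]_n) :
  `|\tr G| ^+ 2 <= (\rank G)%:R * \sum_i \sum_j `|G i j| ^+ 2.
Proof.
have [r [rE [A [B [GE BU]]]]] : exists r, r = \rank G /\
    exists (A : 'M[C]_(n, r)) (B : 'M[C]_(r, n)), G = A *m B /\ B \is unitarymx.
  exists (\rank G); split=> //.
  have /submxP[A GE] : (G <= schmidt (row_base G))%MS.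
    by rewrite (submx_trans _ (schmidt_sub _))// eq_row_base.
  exists A, (schmidt (row_base G)); split=> //.
  exact/schmidt_unitarymx/rank_leq_row.
have HSE (m p : nat) (M : 'M[C]_(m, p)) :
    \sum_i \sum_j `|M i j| ^+ 2 = \tr (M *m M ^t*).
  apply: eq_bigr => i _; rewrite mxE; apply: eq_bigr => j _.
  by rewrite !mxE normCK.
have GA : \tr (A *m A ^t*) = \tr (G *m G ^t*).
  by rewrite GE trmx_mul map_mxM /= mulmxA -(mulmxA A) (unitarymxP BU) mulmx1.
have -> : \tr G = \sum_(p : 'I_n * 'I_r) A p.1 p.2 * B p.2 p.1.
  rewrite -(pair_bigA _ (fun i j => A i j * B j i)) /=.
  by rewrite {1}GE; apply: eq_bigr => i _; rewrite mxE.
apply: (le_trans (CauchySchwarz_sum _ _)); rewrite mulrC.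
rewrite -(pair_bigA _ (fun i j => `|A i j| ^+ 2)) /=.
rewrite -(pair_bigA _ (fun i j => `|B j i| ^+ 2)) /=.
by rewrite exchange_big /= !HSE GA (unitarymxP BU) mxtrace1 rE.
Qed.

(** Each row outside [S] combines rows of strictly larger key. As keys are bounded on a finite type,
    repeated substitution ends in the span of the rows of [S], so the rank is at most [#|S|]. *)
Lemma normC_trace_le_rows (C : numClosedFieldType) (T : finType)
    (G : T -> T -> C) (S : {set T}) (key : T -> nat) :
  (forall P, P \notin S -> exists2 r : seq (C * T),
     all (fun x => key P < key x.2)%N r &
     forall Q, G P Q = \sum_(x <- r) x.1 * G x.2 Q) ->
  `|\sum_P G P P| ^+ 2 <= #|S|%:R * \sum_P \sum_Q `|G P Q| ^+ 2.
Proof.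
move=> GS; pose M : 'M[C]_#|T| := \matrix_(i, j) G (enum_val i) (enum_val j).
have evR (F : T -> C) : \sum_(i < #|T|) F (enum_val i) = \sum_P F P.
  by rewrite (reindex _ (onW_bij _ (enum_val_bij T))).
pose MS : 'M[C]_(#|S|, #|T|) := \matrix_(i, j) G (enum_val i) (enum_val j).
pose g P : 'rV[C]_#|T| := \row_j G P (enum_val j).
have gS P : (g P <= MS)%MS.
  have [n] := ubnP (\max_Q key Q - key P)%N; elim: n P => // n IH P kn.
  have [PS|/GS[a /allP aP aE]] := boolP (P \in S).
    rewrite (_ : g P = row (enum_rank_in PS P) MS) ?row_sub//.
    by apply/rowP => j; rewrite !mxE enum_rankK_in.
  have -> : g P = \sum_(x <- a) x.1 *: g x.2.
    apply/rowP => j; rewrite mxE aE summxE; apply: eq_bigr => x _.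
    by rewrite !mxE.
  rewrite big_seq; apply: summx_sub => x /aP Px; apply/scalemx_sub/IH.
  rewrite -ltnS; apply: leq_ltn_trans kn; apply: ltn_sub2l => //.
  by rewrite (leq_trans Px)// leq_bigmax.
have MMS : (M <= MS)%MS.
  apply/row_subP => i; rewrite (_ : row i M = g (enum_val i)) ?gS//.
  by apply/rowP => j; rewrite !mxE.
have := normC_trace_le_rank M.
have -> : \tr M = \sum_P G P P.
  by rewrite -evR; apply: eq_bigr => i _; rewrite mxE.
have -> : \sum_i \sum_j `|M i j| ^+ 2 = \sum_P \sum_Q `|G P Q| ^+ 2.
  rewrite -evR; apply: eq_bigr => i _; rewrite -evR; apply: eq_bigr => j _.
  by rewrite mxE.
move=> /le_trans; apply; apply: ler_wpM2r.
  by apply: sumr_ge0 => P _; apply: sumr_ge0 => Q _; rewrite exprn_ge0.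
by rewrite ler_nat (leq_trans (mxrankS MMS))// rank_leq_row.
Qed.

Lemma card_boundary_ord N E :
  (#|[set i : 'I_N | (i < E) || (N <= i + E)]%N| <= 2 * E)%N.
Proof.
rewrite cardE -(size_map val).
have -> : (2 * E = size (iota 0 E ++ iota (N - E) E))%N.
  by rewrite size_cat !size_iota; lia.
apply: uniq_leq_size; first by rewrite (map_inj_uniq val_inj) enum_uniq.
move=> _ /mapP[i + ->]; rewrite mem_enum inE mem_cat !mem_iota /=.
have := ltn_ord i; lia.
Qed.

(** Second coordinates differ by at most [2D], so the weight [2D + 1] makes the linear form
    injective on [s]: it realises the lexicographic order, and its maximum is attained once. *)
Lemma strict_max_linear (s : seq (int * int)) (D : nat) :
  s != [::] -> (forall l, l \in s -> (`|l.2| <= D)%N) ->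
  exists2 l0, l0 \in s & forall l, l \in s -> l != l0 ->
    (D.*2.+1%:Z * l.1 + l.2 < D.*2.+1%:Z * l0.1 + l0.2)%R.
Proof.
elim: s => // l s IH _ sD.
have [s0|/IH[k ks|l0 l0s l0m]] := eqVneq s [::].
- by exists l => [|k]; rewrite s0 !inE ?eqxx// => ->.
- by apply: sD; rewrite inE ks orbT.
have := sD l (mem_head _ _); have := sD l0; rewrite inE l0s orbT => /(_ isT).
case: (ltgtP (D.*2.+1%:Z * l.1 + l.2) (D.*2.+1%:Z * l0.1 + l0.2)) => ll0 D0 D1.
- exists l0 => [|k]; first by rewrite inE l0s orbT.
  by rewrite inE => /predU1P[->//|/l0m].
- exists l => [|k]; rewrite inE ?eqxx// => /predU1P[->/eqP//|ks kl].
  have [->//|/(l0m _ ks)] := eqVneq k l0.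
  by move=> /lt_trans; apply.
- exists l0 => [|k]; first by rewrite inE l0s orbT.
  rewrite inE => /predU1P[-> /eqP[]|/l0m//].
  case: l l0 ll0 D0 D1 {IH sD l0s l0m} => [a b] [a' b'] /= e D0 D1.
  have aa' : a = a' by nia.
  by subst; congr pair; lia.
Qed.

Definition box N (i : 'I_N * 'I_N) : int * int := (i.1%:Z, i.2%:Z).

(** The relation at [P + l0], with [l0] the strict maximum of the linear form on [s], expresses row
    [P] through the rows [P + l0 - l], whose keys are larger. Only rows near the border of the box
    escape, where such a point may leave it. [E] depends on [s] alone. *)
Lemma normC_trace_le_box (C : numClosedFieldType) (s : seq (int * int)) :
  uniq s -> s != [::] -> exists E : nat,
  forall (c : int * int -> int * int -> C) (G : int * int -> int * int -> C),
  (forall P l, l \in s -> c P l != 0) ->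
  (forall P Q, \sum_(l <- s) c P l * G (P - l) Q = 0) ->
  forall N,
  `|\sum_(i : 'I_N * 'I_N) G (box i) (box i)| ^+ 2 <=
    (E * N)%:R * \sum_(i : 'I_N * 'I_N) \sum_(j : 'I_N * 'I_N)
      `|G (box i) (box j)| ^+ 2.
Proof.
move=> us s0; pose D := (\max_(l <- s) maxn `|l.1| `|l.2|)%N.
have sD l : l \in s -> (`|l.1| <= D)%N /\ (`|l.2| <= D)%N.
  move=> ls; apply/andP; rewrite -geq_max.
  exact: (leq_bigmax_seq (F := fun l : int * int => maxn `|l.1| `|l.2|)%N).
have [l0 l0s l0m] := strict_max_linear s0 (fun l ls => proj2 (sD l ls)).
(* Shifts [l0 - l] have coordinates at most [2D] in size; the border strip of this width has at most
   [4D] indices in each of the two directions, hence at most [8DN] points. *)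
exists (8 * D)%N => c G c0 cG N.
pose S1 := [set i : 'I_N | (i < D.*2) || (N <= i + D.*2)]%N.
pose S := finset.setU (finset.setX S1 finset.setT)
  (finset.setX finset.setT S1).
apply: (le_trans (normC_trace_le_rows (G := fun i j => G (box i) (box j))
  (S := S) (key := fun i => (D.*2.+1 * i.1 + i.2)%N) _)); last first.
  apply: ler_wpM2r.
    by apply: sumr_ge0 => P _; apply: sumr_ge0 => Q _; rewrite exprn_ge0.
  rewrite ler_nat (leq_trans (leq_card_setU _ _))// !cardsX cardsT card_ord.
  by have := card_boundary_ord N D.*2; rewrite -/S1; nia.
move=> [i j]; rewrite !inE /= !andbT negb_or => /andP[iS jS].
pose P : int * int := box (i, j) + l0.
(* The defaults [i] and [j] are never reached for [l] in [s]: [P - l] then lies in the box. *)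
pose to l : 'I_N * 'I_N :=
  (insubd i `|((P - l)%R).1|%N, insubd j `|((P - l)%R).2|%N).
have toE l : l \in s -> box (to l) = P - l.
  move=> ls; have [Da Db] := sD _ ls; have [Da0 Db0] := sD _ l0s.
  rewrite /box /to /= !val_insubd /P.
  case: l l0 Da Db Da0 Db0 {ls l0s l0m to P}.
  move=> a b [a0 b0] /= *; rewrite !ifT; last 2 first.
  - by lia.
  - by lia.
  by rewrite [RHS]surjective_pairing; congr pair; rewrite /=; lia.
exists [seq (- c P l / c P l0, to l) | l <- s & l != l0].
  apply/allP => _ /mapP[l + ->] /=; rewrite mem_filter => /andP[ll0 ls].
  have /= := l0m _ ls ll0; have:= congr1 snd (toE _ ls).
  have := congr1 fst (toE _ ls); rewrite /P /=.
  by move: (to l) => -[a b] /=; move: l.1 l.2 l0.1 l0.2 (D.*2) => *; nia.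
move=> Q; have := cG P (box Q); rewrite (bigD1_seq l0)//= addrK.
rewrite big_map big_filter => /eqP; rewrite addr_eq0 => /eqP cE.
apply: (mulfI (c0 P l0 l0s)); rewrite cE mulr_sumr -sumrN.
rewrite big_seq_cond [RHS]big_seq_cond; apply: eq_bigr => l /andP[ls _].
by rewrite toE//= mulrA [c P l0 * _]mulrC divfK ?c0// mulNr.
Qed.

End trace_bounds.

Local Open Scope classical_set_scope.
Local Open Scope ring_scope.

(** * Roots of unity *)

Lemma sum_geometric_root1 (F : fieldType) (x : F) N :
  x ^+ N = 1 -> x != 1 -> \sum_(n < N) x ^+ n = 0.
Proof.
move=> xN x1; have := subrX1 x N.
by rewrite xN subrr => /esym/eqP; rewrite mulf_eq0 subr_eq0 (negbTE x1) => /eqP.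
Qed.

(** Expanding the square and summing over [n] first leaves geometric sums of powers of [z]. The
    off-diagonal ones vanish, because [J <= N] keeps distinct exponents distinct modulo [N]. *)
Lemma discrete_Parseval (C : numClosedFieldType) (z : C) N J (a : nat -> C) :
  `|z| = 1 -> z ^+ N = 1 -> (forall k, (0 < k < N)%N -> z ^+ k != 1) ->
  (J <= N)%N ->
  \sum_(n < N) `|\sum_(j < J) z ^+ (n * j) * a j| ^+ 2 =
    N%:R * \sum_(j < J) `|a j| ^+ 2.
Proof.
move=> z1 zN zk JN.
have zz : z^* * z = 1 by rewrite mulrC -normCK z1 expr1n.
have z0 : z != 0 by rewrite -normr_eq0 z1 oner_eq0.
transitivity (\sum_(n < N) \sum_(j < J) \sum_(k < J)
    (z ^+ j * (z^*) ^+ k) ^+ n * (a j * (a k)^*)).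
  apply: eq_bigr => n _; rewrite normCK rmorph_sum mulr_suml.
  apply: eq_bigr => j _; rewrite mulr_sumr; apply: eq_bigr => k _.
  by rewrite rmorphM rmorphXn exprMn -!exprM ![(n * _)%N]mulnC; ring.
rewrite exchange_big mulr_sumr; apply: eq_bigr => j _.
rewrite exchange_big (bigD1 j)//= [X in _ + X]big1 ?addr0; last first.
  move=> k kj; rewrite -mulr_suml sum_geometric_root1 ?mul0r//.
    rewrite exprMn -!exprM ![(_ * N)%N]mulnC !exprM zN -rmorphXn zN.
    by rewrite rmorph1 !expr1n mulr1.
  (* The product is [z ^+ (v - u)] with [0 < v - u < N]; the opposite order follows by
     conjugation. *)
  have zne (u v : 'I_J) : (u < v)%N -> z ^+ v * z^* ^+ u != 1.
    move=> uv; rewrite -(subnK (ltnW uv)) exprD -mulrA -exprMn [z * _]mulrC zz.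
    rewrite expr1n mulr1 zk// subn_gt0 uv/= ltn_subLR ?(ltnW uv)//.
    by have := ltn_ord v; lia.
  case: (ltngtP k j) => [/zne//|jk|/val_inj kj'].
    apply/eqP => /(congr1 Num.conj).
    rewrite rmorphM /= !rmorphXn /= conjCK rmorph1 mulrC.
    by apply/eqP; exact: zne.
  by rewrite kj' eqxx in kj.
rewrite -mulr_suml; under eq_bigr do rewrite -exprMn [z * _]mulrC zz !expr1n.
by rewrite sumr_const card_ord normCK.
Qed.

Section cis_theory.
Context (R : realType).
Implicit Types (x y : R).

Lemma cisD x y : cis (x + y) = cis x * cis y.
Proof.
by rewrite /cis cosD sinD; apply/eqP; rewrite eq_complex/=; apply/andP; split;
  apply/eqP; ring.
Qed.

Lemma cis0 : cis 0 = 1 :> R[i].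
Proof. by rewrite /cis cos0 sin0. Qed.

Lemma cisMn x n : cis (x *+ n) = cis x ^+ n.
Proof. by elim: n => [|n IH]; rewrite ?cis0// mulrS cisD IH exprS. Qed.

Lemma normc_cis x : Normc.normc (cis x) = 1.
Proof. by rewrite /= cos2Dsin2 sqrtr1. Qed.

Lemma norm_cis x : `|cis x| = 1.
Proof. by rewrite normc_def /= cos2Dsin2 sqrtr1. Qed.

Lemma cis_neq0 x : cis x != 0.
Proof. by rewrite -normr_eq0 norm_cis oner_eq0. Qed.

Lemma cis2pi : cis (2 * pi) = 1 :> R[i].
Proof. by rewrite /cis mulr_natl cos2pi sin2pi. Qed.

Lemma cis_neq1 x : 0 < x < 1 -> cis (2 * pi * x) != 1.
Proof.
move=> /andP[x0 x1]; apply/eqP => -[] + _.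
rewrite -mulrA mulr_natl cosD -!expr2 cos2sin2 => e.
have : 0 < sin (pi * x).
  by rewrite sin_gt0_pi// ?mulr_gt0 ?pi_gt0//= gtr_pMr ?pi_gt0.
by move=> /(fun h => mulr_gt0 h h); rewrite -expr2; lra.
Qed.

Lemma cis_root_unity N : (0 < N)%N ->
  [/\ `|cis (2 * pi / N%:R) : R[i]| = 1, (cis (2 * pi / N%:R) : R[i]) ^+ N = 1 &
   forall k, (0 < k < N)%N -> (cis (2 * pi / N%:R) : R[i]) ^+ k != 1].
Proof.
move=> N0; have Nn0 : N%:R != 0 :> R by rewrite pnatr_eq0 -lt0n.
split; first exact: norm_cis.
  by rewrite -cisMn -[_ *+ N]mulr_natr divfK// cis2pi.
move=> k /andP[k0 kN]; rewrite -cisMn -[_ *+ k]mulr_natr mulrAC -mulrA.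
apply: cis_neq1; rewrite divr_gt0 ?ltr0n//=.
by rewrite ltr_pdivrMr ?ltr0n// mul1r ltr_nat.
Qed.

End cis_theory.

(** * Sampled functionals *)

Section sampled_matrix.
Context (R : realType).
Implicit Types (p q r x y e : R) (f : R -> R[i]) (P Q l : int * int).

Lemma normcE (z : R[i]) : `|z| = (Normc.normc z)%:C%C.
Proof. by rewrite normc_def; case: z. Qed.

Lemma norm2cE (z : R[i]) : `|z| ^+ 2 = (Normc.normc z ^+ 2)%:C%C.
Proof. by rewrite normcE -rmorphXn. Qed.

(** One coordinate of the lattice point with integer coordinates [P], where [p] and [r] are that
    coordinate of the two basis vectors. *)
Definition zlin p r P : R := P.1%:~R * p + P.2%:~R * r.

Lemma zlinB p r P Q : zlin p r (P - Q) = zlin p r P - zlin p r Q.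
Proof. by rewrite /zlin !intrB; ring. Qed.

(* Squared modulus at frequency n of the discrete Fourier transform of the
   samples f(y), f(y + e), ..., f(y + (J - 1) e), padded to length N. *)
Definition sampled_power f e N J (n : int) y : R :=
  Normc.normc (\sum_(j < J) cis (2 * pi / N%:R * n%:~R * j%:R) *
    f (y + j%:R * e)) ^+ 2.

Lemma sampled_sum_le_power (s : seq (int * int)) : uniq s -> s != [::] ->
  exists E : nat, forall p q r (c : int * int -> R[i]) f N J x,
  (forall l, l \in s -> c l != 0) -> (0 < N)%N -> q != 0 ->
  let e := - (q * N%:R)^-1 in
  (forall P (j : 'I_J), let t := x + j%:R * e + zlin p r P in
    \sum_(l <- s) c l * cis (2 * pi * (l.2%:~R * q) * t) * f (t - zlin p r l)
      = 0) ->
  (N ^ 4)%:R * Normc.normc (\sum_(j < J) f (x + j%:R * e)) ^+ 2 <=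
  (E * N)%:R * \sum_(i : 'I_N * 'I_N) \sum_(k : 'I_N * 'I_N)
    sampled_power f e N J (box i - box k).2 (x + zlin p r (box i - box k)).
Proof.
move=> us s0; have [E EP] := normC_trace_le_box R[i] us s0.
exists E => p q r c f N J x c0 N0 qn0 e rel.
have Nn0 : N%:R != 0 :> R by rewrite pnatr_eq0 -lt0n.
pose t (j : 'I_J) Q := x + j%:R * e - zlin p r Q.
(* The step [e = -1 / (qN)] turns the dependence of the phase on [j] into the character
   [2 pi (P - Q).2 j / N]; the rest of the phase is independent of [j], so the entries are discrete
   Fourier coefficients up to a unimodular factor. *)
pose G P Q := \sum_(j < J) cis (- (2 * pi * (P - Q).2%:~R * q * t j Q)) *
  f (x + j%:R * e + zlin p r (P - Q)).
have GE P Q : `|G P Q| ^+ 2 =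
    (sampled_power f e N J (P - Q).2 (x + zlin p r (P - Q)))%:C%C.
  rewrite /sampled_power -norm2cE.
  rewrite (_ : G P Q = cis (- (2 * pi * (P - Q).2%:~R * q * (x - zlin p r Q)))
    * \sum_(j < J) cis (2 * pi / N%:R * (P - Q).2%:~R * j%:R) *
      f (x + zlin p r (P - Q) + j%:R * e)).
    by rewrite normrM norm_cis mul1r.
  rewrite mulr_sumr; apply: eq_bigr => j _; rewrite mulrA -cisD addrAC.
  by congr (cis _ * _); rewrite /t /e; field; rewrite Nn0 qn0.
have c0' P l : l \in s ->
    c l * cis (2 * pi * (l.2%:~R * q) * zlin p r P) != 0.
  by move=> ls; rewrite mulf_neq0 ?c0 ?cis_neq0.
have rG P Q : \sum_(l <- s) c l * cis (2 * pi * (l.2%:~R * q) * zlin p r P) *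
    G (P - l) Q = 0.
  transitivity (\sum_(j < J) cis (- (2 * pi * (P - Q).2%:~R * q * t j Q)) *
    \sum_(l <- s) c l * cis (2 * pi * (l.2%:~R * q) *
        (x + j%:R * e + zlin p r (P - Q))) *
      f (x + j%:R * e + zlin p r (P - Q) - zlin p r l)); last first.
    by rewrite big1// => j _; rewrite rel mulr0.
  under eq_bigr do rewrite mulr_sumr.
  rewrite exchange_big /=; apply: eq_bigr => j _.
  rewrite mulr_sumr; apply: eq_bigr => l _.
  have -> : zlin p r (P - l - Q) = zlin p r (P - Q) - zlin p r l.
    by rewrite !zlinB; ring.
  rewrite [x + _ + (_ - _)]addrA.
  (* The twist is chosen so that, after moving from [P] to [P - l], the discrepancy in phase depends
     on [P] and [l] only. One recurrence therefore serves every column [Q] and every sample [j]. *)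
  have phase : cis (2 * pi * (l.2%:~R * q) * zlin p r P) *
      cis (- (2 * pi * (P - l - Q).2%:~R * q * t j Q)) =
      cis (- (2 * pi * (P - Q).2%:~R * q * t j Q)) *
      cis (2 * pi * (l.2%:~R * q) * (x + j%:R * e + zlin p r (P - Q))).
    by rewrite -!cisD /t zlinB /= !intrB; congr cis; ring.
  ring: phase.
have := EP _ G c0' rG N.
(* On the diagonal [P - Q = 0], so the phase is trivial and all [N ^ 2] entries equal the sampled
   sum. *)
rewrite (_ : \sum_i _ = (N ^ 2)%:R * \sum_(j < J) f (x + j%:R * e)); last first.
  transitivity (\sum_(i : 'I_N * 'I_N) \sum_(j < J) f (x + j%:R * e)).
    apply: eq_bigr => i _; apply: eq_bigr => j _.
    by rewrite subrr /zlin mulr0 !mul0r oppr0 cis0 mul1r !addr0.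
  by rewrite sumr_const card_prod card_ord mulr_natl.
have -> : \sum_(i : 'I_N * 'I_N) \sum_(k : 'I_N * 'I_N)
    `|G (box i) (box k)| ^+ 2 = (\sum_(i : 'I_N * 'I_N)
    \sum_(k : 'I_N * 'I_N) sampled_power f e N J (box i - box k).2
      (x + zlin p r (box i - box k)))%:C%C.
  rewrite rmorph_sum; apply: eq_bigr => i _.
  by rewrite rmorph_sum; apply: eq_bigr => k _; exact: GE.
rewrite normrM normr_nat exprMn norm2cE -natrX -expnM.
by rewrite -!(rmorph_nat (real_complex R)) -!rmorphM lecR.
Qed.

End sampled_matrix.

(** * Integration of the sampled powers over a period *)

Section integrated_power.
Context (R : realType).
Local Notation mu := (@lebesgue_measure R).
Implicit Types (p q r x y e : R) (f h : L2fun R).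

Lemma measurable_shift x : measurable_fun [set: R] (fun t : R => t + x).
Proof. by apply: measurable_funD => //; exact: measurable_cst. Qed.

Lemma ge0_integral_shift x (g : R -> \bar R) : measurable_fun setT g ->
  (forall t, 0 <= g t)%E -> (\int[mu]_t g (t + x)%R = \int[mu]_t g t)%E.
Proof.
move=> mg g0.
pose phi (t : R) : measurableTypeR R := t - - x.
have mphi : measurable_fun setT phi.
  by rewrite /phi opprK; exact: measurable_shift.
transitivity (\int[pushforward mu phi]_t g t)%E.
  rewrite ge0_integral_pushforward//.
  by apply: eq_integral => t _; rewrite /= /phi opprK.
apply: eq_measure_integral => A mA _.
exact: (lebesgue_measure_sub (- x) mA).
Qed.

(** Translates of a half-open interval of length [p] by distinct multiples of [p] are disjoint, so
    the sum is one integral over their union. *)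
Lemma sum_integral_translates p x0 b N (g : R -> \bar R) : 0 < p ->
  measurable_fun setT g -> (forall t, 0 <= g t)%E ->
  (\sum_(i < N) \int[mu]_(x in `[x0, (x0 + p)%R[) g (x + (i%:R * p + b))%R <=
    \int[mu]_x g x)%E.
Proof.
move=> p0 mg g0.
pose I := `[x0, x0 + p[%classic.
have mI : measurable I by exact: measurable_itv.
pose A (i : nat) := [set t : R | I (t - (i%:R * p + b))].
have mA i : measurable (A i).
  rewrite (_ : A i = (fun t => t + - (i%:R * p + b)) @^-1` I)//.
  by rewrite -[X in measurable X]setTI; exact: measurable_shift.
have -> : (\sum_(i < N) \int[mu]_(x in I) g (x + (i%:R * p + b))%R =
    \sum_(i < N) \int[mu]_(x in A i) g x)%E.
  apply: eq_bigr => i _; rewrite integral_mkcond [RHS]integral_mkcond.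
  rewrite -[RHS](ge0_integral_shift (i%:R * p + b)).
  - apply: eq_integral => x _; rewrite !patchE; congr (if _ then _ else _).
    by rewrite /A; apply/idP/idP; rewrite !inE /= addrK.
  - by apply/(measurable_restrictT _ _).1 => //; exact: measurable_funS mg.
  - by move=> t; rewrite patchE; case: ifP.
rewrite -(big_mkord xpredT (fun i => \int[mu]_(x in A i) g x)%E).
rewrite -ge0_integral_bigsetU//=; last 3 first.
- exact: iota_uniq.
- apply/trivIsetP => i j _ _ ij; rewrite -subset0 => t [].
  rewrite /A /I /= !in_itv/= => /andP[i1 i2] /andP[j1 j2].
  have : (i%:Z%:~R - j%:Z%:~R) * p < 1%:Z%:~R * p :> R
    by rewrite -!pmulrn; lra.
  have : (j%:Z%:~R - i%:Z%:~R) * p < 1%:Z%:~R * p :> R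
    by rewrite -!pmulrn; lra.
  rewrite !ltr_pM2r// -!intrB !ltr_int => ? ?.
  by move/negP: ij; apply; apply/eqP; lia.
- exact: measurable_funTS.
rewrite big_mkord.
apply: ge0_subset_integral => //; apply: bigsetU_measurable => i _; exact: mA.
Qed.

Lemma measurable_sqr_normc_L2 f :
  measurable_fun setT (fun t => (Normc.normc (f t) ^+ 2)%:E : \bar R).
Proof. by have /asboolP[mr mi _] := valP f; exact: measurable_sqr_normc. Qed.

Lemma L2fun_sumE I (s : seq I) (F : I -> L2fun R) y :
  (\sum_(i <- s) F i) y = \sum_(i <- s) F i y.
Proof.
by elim/big_rec2: _ => // i u v _ <-.
Qed.

(** Writing the sampled sum as an element of [L2fun] makes its measurability a consequence of the
    vector space structure. *)
Definition sampled_fun f (a : nat -> R[i]) e J : L2fun R :=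
  \sum_(j < J) a j *: translation_fun (- (j%:R * e)) f.

Lemma sampled_funE f a e J y :
  sampled_fun f a e J y = \sum_(j < J) a j * f (y + j%:R * e).
Proof.
rewrite L2fun_sumE; apply: eq_bigr => j _.
by rewrite [LHS]/(a j * f (y - - (j%:R * e))) opprK.
Qed.

Lemma measurable_sampled_power f e N J n :
  measurable_fun setT (fun y => (sampled_power f e N J n y)%:E).
Proof.
have := measurable_sqr_normc_L2
  (sampled_fun f (fun j => cis (2 * pi / N%:R * n%:~R * j%:R)) e J).
by under eq_fun do rewrite sampled_funE.
Qed.

(** The frequency offset [n0] only multiplies each sample by a number of modulus one, so Parseval
    applies to the modified samples. *)
Lemma sum_sampled_power f e N J (n0 : int) y : (0 < N)%N -> (J <= N)%N ->
  \sum_(n < N) sampled_power f e N J (n%:Z - n0) y =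
  N%:R * \sum_(j < J) Normc.normc (f (y + j%:R * e)) ^+ 2.
Proof.
move=> N0 JN; have [z1 zN zk] := cis_root_unity R N0.
set z : R[i] := cis (2 * pi / N%:R) in z1 zN zk *.
pose a j := cis (- (2 * pi / N%:R * n0%:~R * j%:R)) * f (y + j%:R * e).
apply: (fmorph_inj (real_complex R)).
rewrite rmorph_sum rmorphM rmorph_nat rmorph_sum /=.
under [in RHS]eq_bigr do rewrite -norm2cE.
have := discrete_Parseval a z1 zN zk JN.
under [X in _ = _ * X -> _]eq_bigr do rewrite normrM norm_cis mul1r.
move=> <-; apply: eq_bigr => n _.
rewrite -norm2cE; congr (`|_| ^+ 2); apply: eq_bigr => j _.
rewrite /a mulrA /z -cisMn -cisD; congr (cis _ * _).
by rewrite intrB -[_ *+ (n * j)]mulr_natr natrM -pmulrn; ring.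
Qed.

End integrated_power.

(** * A bound on sampled sums, uniform in the size of the box *)

Section integrated_bound.
Context (R : realType).
Local Notation mu := (@lebesgue_measure R).
Local Notation aeS := (@filterS _ _ (ae_filter_ringOfSetsType mu)).
Implicit Types (p q r x y e : R) (f : L2fun R).

Definition sqr_norm f : R := fine (\int[mu]_t (Normc.normc (f t) ^+ 2)%:E).

Lemma sqr_normE f :
  (\int[mu]_t (Normc.normc (f t) ^+ 2)%:E = (sqr_norm f)%:E)%E.
Proof.
have /asboolP[_ _ fF] := valP f; rewrite fineK// ge0_fin_numE//.
by apply: integral_ge0 => t _; rewrite lee_fin sqr_ge0.
Qed.

Lemma sampled_power_ge0 (g : R -> R[i]) e N J n y :
  0 <= sampled_power g e N J n y.
Proof. exact: sqr_ge0. Qed.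

(** In a fixed column [k], the first coordinate of [i] moves the period along the line, which yields
    integrals over the whole line; the second runs over [N] consecutive frequencies, which Parseval
    sums to [J] translates of [f]. *)
Lemma sum_integral_sampled_power p r x0 e f N J (k : 'I_N * 'I_N) : 0 < p ->
  (J <= N)%N ->
  (\sum_(i : 'I_N * 'I_N) \int[mu]_(x in `[x0, (x0 + p)%R[)
    (sampled_power f e N J (box i - box k).2
      (x + zlin p r (box i - box k))%R)%:E <= (N%:R * J%:R * sqr_norm f)%:E)%E.
Proof.
move=> p0 JN; have N0 : (0 < N)%N by exact: leq_ltn_trans (ltn_ord k.1).
rewrite -(pair_big predT predT (fun i1 i2 => \int[mu]_(x in `[x0, (x0 + p)%R[)
    (sampled_power f e N J (box (i1, i2) - box k).2
      (x + zlin p r (box (i1, i2) - box k))%R)%:E))%E /=.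
rewrite exchange_big /=.
pose g n y := (sampled_power f e N J (n%:Z - k.2%:Z) y)%:E.
have mg n : measurable_fun setT (g n) by exact: measurable_sampled_power.
have g0 n y : (0 <= g n y)%E by rewrite lee_fin sampled_power_ge0.
apply: (@le_trans _ _ (\sum_(n < N) \int[mu]_y g n y)%E).
  apply: lee_sum => n _.
  (* [b] is the part of the shift that does not depend on the first coordinate of the row. *)
  pose b := (n%:Z - k.2%:Z)%:~R * r - k.1%:R * p.
  apply: le_trans (sum_integral_translates x0 b N p0 (mg n) (g0 n)).
  rewrite le_eqVlt; apply/orP; left; apply/eqP/eq_bigr => m _.
  apply: eq_integral => x _; rewrite /g /box /=.
  congr (sampled_power _ _ _ _ _ _)%:E.
  by rewrite /zlin /b /= intrB -!pmulrn; ring.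
rewrite -ge0_integral_sum//; last by move=> n; exact: mg.
pose h j y := (Normc.normc (f (y + j%:R * e)) ^+ 2)%:E : \bar R.
have mh j : measurable_fun setT (h j).
  apply: (measurableT_comp (measurable_sqr_normc_L2 f)).
  exact: measurable_shift.
have h0 j y : (0 <= h j y)%E by rewrite lee_fin sqr_ge0.
rewrite (_ : (\int[mu]_x _)%E =
    (\int[mu]_y (N%:R%:E * \sum_(j < J) h j y))%E); last first.
  apply: eq_integral => y _.
  by rewrite /g sumEFin sum_sampled_power// /h sumEFin -EFinM.
rewrite ge0_integralZl//; last 2 first.
- by apply: emeasurable_sum => j; exact: mh.
- by move=> y _; apply: sume_ge0.
rewrite ge0_integral_sum//; last by move=> j; exact: mh.
rewrite (eq_bigr (fun=> (sqr_norm f)%:E)); last first.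
  move=> j _; rewrite -sqr_normE.
  apply: (ge0_integral_shift (j%:R * e) (measurable_sqr_normc_L2 f)).
  by move=> t; rewrite lee_fin sqr_ge0.
by rewrite sumEFin sumr_const card_ord -EFinM lee_fin -[_ *+ J]mulr_natl mulrA.
Qed.

(** Integrating the pointwise estimate gives [N ^ 4] on the left; on the right come [E N] from the
    rank, [N ^ 2] columns and [N J] from each column. The powers of [N] cancel. *)
Lemma integral_sampled_sum_le (s : seq (int * int)) : uniq s -> s != [::] ->
  exists E : nat, forall p q r (c : int * int -> R[i]) f,
  (forall l, l \in s -> c l != 0) -> 0 < p -> q != 0 ->
  {ae mu, forall t : R, \sum_(l <- s)
    c l * cis (2 * pi * (l.2%:~R * q) * t) * f (t - zlin p r l) = 0} ->
  forall x0 N J, (0 < N)%N -> (J <= N)%N ->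
  (\int[mu]_(x in `[x0, (x0 + p)%R[)
    (Normc.normc (\sum_(j < J) f (x - j%:R / (q * N%:R))) ^+ 2)%:E <=
    (E%:R * J%:R * sqr_norm f)%:E)%E.
Proof.
move=> us s0; have [E EP] := sampled_sum_le_power R us s0.
exists E => p q r c f c0 p0 qn0 rel x0 N J N0 JN.
set e : R := - (q * N%:R)^-1.
pose S x := Normc.normc (\sum_(j < J) f (x + j%:R * e)) ^+ 2.
have -> : (\int[mu]_(x in `[x0, (x0 + p)%R[)
    (Normc.normc (\sum_(j < J) f (x - j%:R / (q * N%:R))) ^+ 2)%:E)%E =
    (\int[mu]_(x in `[x0, (x0 + p)%R[) (S x)%:E)%E.
  apply: eq_integral => x _; rewrite /S /e.
  by under [in RHS]eq_bigr do rewrite mulrN.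
have mS : measurable_fun setT (fun x => (S x)%:E).
  have := measurable_sqr_normc_L2 (sampled_fun f (fun=> 1) e J).
  under eq_fun do rewrite sampled_funE.
  by under eq_fun do under eq_bigr do rewrite mul1r.
pose W (i k : 'I_N * 'I_N) x := (sampled_power f e N J (box i - box k).2
  (x + zlin p r (box i - box k)))%:E.
have mW i k : measurable_fun setT (W i k).
  apply: (measurableT_comp (measurable_sampled_power f e N J _)).
  exact: measurable_shift.
have W0 i k x : (0 <= W i k x)%E by rewrite lee_fin sampled_power_ge0.
have good : {ae mu, forall x, ((N ^ 4)%:R%:E * (S x)%:E <=
    (E * N)%:R%:E * \sum_i \sum_k W i k x)%E}.
  have rels : {ae mu, forall x : R, forall P (j : 'I_J),
      let t := x + j%:R * e + zlin p r P in \sum_(l <- s)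
        c l * cis (2 * pi * (l.2%:~R * q) * t) * f (t - zlin p r l) = 0}.
    (* The relation is needed at all lattice shifts of all samples at once. These are countably
       many, enumerated by [unpickle], so the exceptional sets still have a null union. *)
    have : {ae mu, forall x : R, forall n : nat,
        forall d, (unpickle n : option ((int * int) * 'I_J)) = Some d ->
      let t := x + d.2%:R * e + zlin p r d.1 in \sum_(l <- s)
        c l * cis (2 * pi * (l.2%:~R * q) * t) * f (t - zlin p r l) = 0}.
      apply: ae_foralln => n; case: (unpickle n) => [d|]; last exact: aeW.
      have := ae_sub (- (d.2%:R * e + zlin p r d.1)) rel.
      apply: aeS => x + _ [<-].
      by rewrite opprK addrA.
    apply: aeS => x xP P j.
    exact: (xP (pickle (P, j)) (P, j) (pickleK _)).
  apply: aeS rels => x /(EP p q r c f N J x c0 N0 qn0).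
  have -> : (\sum_i \sum_k W i k x)%E = (\sum_(i : 'I_N * 'I_N)
      \sum_(k : 'I_N * 'I_N) sampled_power f e N J (box i - box k).2
        (x + zlin p r (box i - box k)))%:E.
    by rewrite -sumEFin; apply: eq_bigr => i _; rewrite -sumEFin.
  by rewrite -!EFinM lee_fin.
have mI : measurable (`[x0, (x0 + p)%R[%classic : set R) by [].
have : (\int[mu]_(x in `[x0, (x0 + p)%R[) ((N ^ 4)%:R%:E * (S x)%:E) <=
  \int[mu]_(x in `[x0, (x0 + p)%R[)
    ((E * N)%:R%:E * \sum_k \sum_i W i k x))%E.
  apply: ae_ge0_le_integral => //.
  - by move=> x _; rewrite -EFinM lee_fin mulr_ge0 ?sqr_ge0.
  - by apply: measurable_funeM; exact: measurable_funTS.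
  - move=> x _; rewrite mule_ge0 ?lee_fin//.
    by apply: sume_ge0 => k _; exact: sume_ge0.
  - apply: measurable_funTS; apply: measurable_funeM.
    by apply: emeasurable_sum => k; apply: emeasurable_sum => i; exact: mW.
  - by apply: aeS good => x + _; rewrite exchange_big.
rewrite ge0_integralZl//; last 2 first.
- exact: measurable_funTS.
- by move=> x _; rewrite lee_fin sqr_ge0.
rewrite ge0_integralZl//; last 2 first.
- apply: measurable_funTS.
  by apply: emeasurable_sum => k; apply: emeasurable_sum => i; exact: mW.
- by move=> x _; apply: sume_ge0 => k _; exact: sume_ge0.
rewrite ge0_integral_sum//; last 2 first.
- move=> k; apply: measurable_funTS.
  by apply: emeasurable_sum => i; exact: mW.
- by move=> k x _; exact: sume_ge0.
set K := (N%:R * J%:R * sqr_norm f).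
move=> Hle; have {Hle} : ((N ^ 4)%:R%:E *
    \int[mu]_(x in `[x0, (x0 + p)%R[) (S x)%:E <=
    (E * N)%:R%:E * \sum_(k : 'I_N * 'I_N) K%:E)%E.
  apply: (le_trans Hle); apply: lee_wpmul2l; first by rewrite lee_fin.
  apply: lee_sum => k _; rewrite ge0_integral_sum//; last first.
    by move=> i; apply: measurable_funTS; exact: mW.
  exact: sum_integral_sampled_power.
rewrite sumEFin sumr_const card_prod card_ord -EFinM.
have -> : (E * N)%:R * (K *+ (N * N)) = (N ^ 4)%:R * (E%:R * J%:R * sqr_norm f).
  by rewrite /K -[_ *+ (N * N)]mulr_natr natrX !natrM; ring.
by rewrite EFinM lee_pmul2l// ?lte_fin ?ltr0n ?expn_gt0 ?N0.
Qed.

End integrated_bound.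

(** * From sampled sums to pointwise vanishing *)

Section vanishing.
Context (R : realType).
Local Notation mu := (@lebesgue_measure R).
Local Notation aeS := (@filterS _ _ (ae_filter_ringOfSetsType mu)).
Implicit Types (a b p h C x s : R) (g : R -> R).

Lemma integral_itv_shift a b s (u : R -> \bar R) : measurable_fun setT u ->
  (\int[mu]_(x in `]a, b]) u (x + s)%R =
   \int[mu]_(x in `](a + s)%R, (b + s)%R]) u x)%E.
Proof.
have ge0 (v : R -> \bar R) : measurable_fun setT v -> (forall t, 0 <= v t)%E ->
    (\int[mu]_(x in `]a, b]) v (x + s)%R =
     \int[mu]_(x in `](a + s)%R, (b + s)%R]) v x)%E.
  move=> mv v0; rewrite integral_mkcond [RHS]integral_mkcond.
  rewrite -[RHS](ge0_integral_shift s).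
  - apply: eq_integral => x _; rewrite !patchE; congr (if _ then _ else _).
    by apply/idP/idP; rewrite !inE /= !in_itv/= ltrD2r lerD2r.
  - by apply/(measurable_restrictT _ _).1 => //; exact: measurable_funTS.
  - by move=> t; rewrite patchE; case: ifP.
move=> mu'; rewrite integralE [RHS]integralE; congr (_ - _)%E.
  rewrite -(ge0 (u^\+)%E); [|exact: measurable_funepos|by []].
  by apply: eq_integral => x _; rewrite !funeposE.
rewrite -(ge0 (u^\-)%E); [|exact: measurable_funeneg|by []].
by apply: eq_integral => x _; rewrite !funenegE.
Qed.

Section sampled_sums.
Variables (g : R -> R) (p h C : R).
Hypothesis p0 : 0 < p.
Hypothesis mg : measurable_fun setT g.
Hypothesis ig : forall a b, mu.-integrable `]a, b] (EFin \o g).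
Hypothesis bound : forall x0 N J, (0 < N)%N -> (J <= N)%N ->
  (\int[mu]_(x in `[x0, (x0 + p)%R[)
    ((\sum_(j < J) g (x - j%:R * h / N%:R)) ^+ 2)%:E <= (C * J%:R)%:E)%E.

Let ig_shift a b s : mu.-integrable `]a, b] (fun x => (g (x + s))%:E).
Proof.
apply/integrableP; split.
  apply/measurable_EFinP/measurable_funTS/(measurableT_comp mg).
  exact: measurable_shift.
have /integrableP[_] := ig (a + s) (b + s).
rewrite -(integral_itv_shift a b s (u := fun x => `|(g x)%:E|%E))//.
by apply: measurableT_comp => //; exact/measurable_EFinP.
Qed.

(** With [k ^ 2] samples, [bound] controls the square integral by [C k ^ 2], and
    [|G| <= G ^ 2 / k + k] turns this into a bound of order [k] on a sum of [k ^ 2] terms. *)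
Let sum_shift_le a b N k : a < b -> b < a + p -> (0 < k)%N -> (k ^ 2 <= N)%N ->
  `|\sum_(j < k ^ 2) \int[mu]_(x in `]a, b]) g (x - j%:R * h / N%:R)|
    <= k%:R * (C + p).
Proof.
move=> ab bp k0 kN; have k0' : 0 < k%:R :> R by rewrite ltr0n.
have N0 : (0 < N)%N by apply: leq_trans kN; rewrite expn_gt0 k0.
pose G x := \sum_(j < k ^ 2) g (x - j%:R * h / N%:R).
have mG : measurable_fun setT G.
  apply: measurable_sum => j; apply: (measurableT_comp mg).
  exact: measurable_shift.
have iG : mu.-integrable `]a, b] (EFin \o G).
  under [X in _.-integrable _ X]eq_fun do rewrite /= -sumEFin.
  by apply: integrable_sum => // j _; exact: ig_shift.
have -> : \sum_(j < k ^ 2) \int[mu]_(x in `]a, b]) g (x - j%:R * h / N%:R) =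
    \int[mu]_(x in `]a, b]) G x.
  rewrite /Rintegral; under [in RHS]eq_integral do rewrite /G -sumEFin.
  rewrite integral_sum//.
  apply: sum_fine => j _; apply: integrable_fin_num => //; exact: ig_shift.
apply: (le_trans (le_normr_Rintegral _ iG)) => //.
rewrite -lee_fin /Rintegral fineK; last first.
  by apply: integrable_fin_num => //; exact: integrable_norm iG.
apply: (@le_trans _ _ (\int[mu]_(x in `]a, b])
    (k%:R^-1%:E * (G x ^+ 2)%:E + k%:R%:E))%E).
  apply: ge0_le_integral => //.
  - by apply/measurable_EFinP/measurable_funTS/measurableT_comp.
  - apply: emeasurable_funD => //; apply: measurable_funeM.
    by apply/measurable_EFinP/measurable_funTS/measurable_funX.
  - move=> x _; rewrite -EFinM -EFinD lee_fin.
    rewrite -(ler_pM2l k0') mulrDr mulrA divff ?gt_eqF// mul1r.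
    rewrite -[G x ^+ 2]real_normK ?num_real//.
    have := sqr_ge0 (`|G x| - k%:R); have := sqr_ge0 `|G x|.
    by have := sqr_ge0 (k%:R : R); nra.
rewrite ge0_integralD//; last 2 first.
- by move=> x _; rewrite -EFinM lee_fin mulr_ge0 ?sqr_ge0// invr_ge0 ltW.
- apply: measurable_funeM.
  exact/measurable_EFinP/measurable_funTS/measurable_funX.
rewrite ge0_integralZl//; last 2 first.
- by apply/measurable_EFinP/measurable_funTS/measurable_funX.
- by move=> x _; rewrite lee_fin sqr_ge0.
rewrite integral_cst//= lebesgue_measure_itv/= lte_fin ab -EFinB.
rewrite mulrDr [leRHS]EFinD; apply: leeD; last first.
  by rewrite -EFinM lee_fin ler_wpM2l ?ltW//; lra.
apply: (@le_trans _ _ (k%:R^-1%:E * (C * (k ^ 2)%:R)%:E)%E).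
  apply: lee_wpmul2l; first by rewrite lee_fin invr_ge0 ltW.
  apply: le_trans (bound a N0 kN).
  apply: ge0_subset_integral => //.
  - by apply/measurable_EFinP/measurable_funTS/measurable_funX.
  - by move=> x _; rewrite lee_fin sqr_ge0.
  - move=> x /=; rewrite !in_itv/= => /andP[/ltW -> xb].
    exact: le_lt_trans bp.
rewrite -EFinM lee_fin natrX le_eqVlt; apply/orP; left; apply/eqP.
by field; rewrite gt_eqF.
Qed.

Let F a x := \int[mu]_(t in `]a, x]) g t.

Let cF a x : a < x -> {for x, continuous (F a)}.
(* The integrability hypothesis concerns intervals open on the left, so the closed interval is
   placed inside one starting at [a - 1]. *)
Proof.
move=> ax.
have ig' : mu.-integrable `[a, x + 1] (EFin \o g).
  apply: integrableS (ig (a - 1) (x + 1)) => // t /=.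
  by rewrite !in_itv/= => /andP[ta ->]; rewrite andbT; lra.
have ax1 : a < x + 1 by lra.
have xI : x \in `]a, x + 1[ by rewrite in_itv/= ax ltrDl ltr01.
have := parameterized_integral_continuous (ltW ax1) ig'.
move=> /(within_continuous_continuous ax1)/(_ xI).
rewrite (_ : (fun y => parameterized_integral mu a y g) = F a)//.
apply/funext => y; rewrite /F /parameterized_integral.
by rewrite -Rintegral_itv_obnd_cbnd.
Qed.

Let F_shift a0 a b s : a0 < a + s -> a < b ->
  \int[mu]_(x in `]a, b]) g (x + s) = F a0 (b + s) - F a0 (a + s).
Proof.
move=> a0s ab.
rewrite Rintegral_itvB//; last 2 first.
- by rewrite bnd_simp ltW.
- by rewrite bnd_simp lerD2r ltW.
rewrite /Rintegral (integral_itv_shift a b s (u := EFin \o g))//.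
exact/measurable_EFinP.
Qed.

(** If the increment had modulus [eta > 0], then for small shifts each of the [k ^ 2] shifted
    increments would stay within [eta / 2] of it, and their sum would be at least [k ^ 2 eta / 2],
    beating the bound [k (C + p)] for large [k]. The base point [a0 < a] leaves room for shifts to
    the left. *)
Let F_locally_constant a0 a b : a0 < a -> a < b -> b < a + p -> F a0 a = F a0 b.
Proof.
move=> a0a ab bp; apply/eqP.
rewrite eq_sym -subr_eq0 -normr_le0 leNgt; apply/negP.
set eta := `|_| => eta0.
pose k := (Num.trunc (2 * (C + p) / eta)).+1.
have kP : 2 * (C + p) < k%:R * eta by rewrite -ltr_pdivrMr// truncnS_gt.
have cb := cF (lt_trans a0a ab); have ca := cF a0a.
have eta4 : 0 < eta / 4 by rewrite divr_gt0.
have [d d0 dP] : exists2 d, 0 < d & forall s, `|s| < d ->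
    [/\ a0 < a + s, `|F a0 b - F a0 (b + s)| < eta / 4
      & `|F a0 a - F a0 (a + s)| < eta / 4].
  have /cvgrPdist_lt/(_ _ eta4)[db /= db0 dbP] := cb.
  have /cvgrPdist_lt/(_ _ eta4)[da /= da0 daP] := ca.
  exists (Num.min (a - a0) (Num.min da db)).
    by rewrite !lt_min subr_gt0 a0a da0 db0.
  move=> s; rewrite !lt_min => /and3P[s0 sa sb]; split.
  - by have := ler_norm (- s); rewrite normrN; lra.
  - by apply: dbP; rewrite /= opprD addNKr normrN.
  - by apply: daP; rewrite /= opprD addNKr normrN.
(* [N] is at least [J], as [bound] requires, and so large that every shift [j h / N] is below the
   continuity threshold [d]. *)
pose J := (k ^ 2)%N.
pose N := (J + (Num.trunc (J%:R * `|h| / d)).+1)%N.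
have N0 : 0 < N%:R :> R by rewrite ltr0n /N addnS.
have NP : J%:R * `|h| < N%:R * d.
  rewrite -ltr_pdivrMr//; apply: (lt_le_trans (truncnS_gt _)).
  by rewrite ler_nat leq_addl.
have sP (j : 'I_J) : `|- (j%:R * h / N%:R)| < d.
  rewrite normrN !normrM normfV !normr_nat ltr_pdivrMr// [ltRHS]mulrC.
  apply: le_lt_trans NP; rewrite ler_wpM2r// ler_nat ltnW//.
have := sum_shift_le ab bp (ltn0Sn _ : 0 < k)%N (leq_addr _ _ : J <= N)%N.
apply/negP; rewrite -ltNge.
set S := \sum_(j < k ^ 2) _.
have D : `|J%:R * (F a0 b - F a0 a) - S| <= J%:R * (eta / 2).
  have sumc (z : R) : J%:R * z = \sum_(j < J) z.
    by rewrite sumr_const card_ord mulr_natl.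
  rewrite !sumc -sumrB; apply: (le_trans (ler_norm_sum _ _ _)).
  apply: ler_sum => j _; have [aj bj aj'] := dP _ (sP j).
  rewrite (F_shift aj ab) opprB addrCA addrA -addrA.
  rewrite [X in `|X|](_ : _ = (F a0 b - F a0 (b + - (j%:R * h / N%:R))) -
    (F a0 a - F a0 (a + - (j%:R * h / N%:R)))); last by ring.
  by apply: (le_trans (ler_normB _ _)); lra.
have JE : J%:R = k%:R * k%:R :> R by rewrite -natrM.
have : J%:R * eta <= `|S| + J%:R * (eta / 2).
  rewrite -[J%:R in X in X <= _]normr_nat -normrM -lerBlDl.
  by apply: le_trans D; exact: lerB_dist.
have : k%:R * (2 * (C + p)) < k%:R * (k%:R * eta).
  by rewrite ltr_pM2l// ltr0n.
by rewrite JE; lra.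
Qed.

(** By Lebesgue differentiation [g] is almost everywhere the derivative of its indefinite integral,
    which is locally constant. *)
Lemma ae0_of_sampled_sum_bound : {ae mu, forall x, g x = 0}.
Proof.
have locg : locally_integrable setT g.
  split=> //; first exact: openT.
  move=> K _ cK; have [M [_ /(_ (M + 1))]] := compact_bounded cK.
  rewrite ltrDl ltr01 => /(_ isT) KM.
  have /integrableP[_] := ig (- (M + 2)) (M + 2).
  apply: le_lt_trans; apply: ge0_subset_integral => //.
  - exact: compact_measurable.
  - by apply/measurable_EFinP/measurable_funTS/measurableT_comp.
  - move=> x /KM /=; rewrite ler_norml in_itv/= => /andP[? ?].
    by apply/andP; split; lra.
(* The indefinite integral needs a finite base point; the points [- n%:R] exhaust the line in
   countably many steps. *)
suff H n : {ae mu, forall x : R, - n%:R < x -> g x = 0}.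
  have := ae_foralln H.
  apply: aeS => x xP.
  apply: (xP (Num.trunc (- x)).+1); rewrite ltrNl; exact: truncnS_gt.
have := @FTC1 R g (BRight (- n%:R)) (fun y => ig _ _) locg.
apply: aeS => x /= xP nx.
have [dF <-] := xP nx.
rewrite derive1E (@near_eq_derive _ _ _ _ (cst (F (- n%:R) x))) ?derive_cst//.
have d0 : 0 < Num.min p (x + n%:R) by rewrite lt_min p0/=; lra.
near=> y; have : `|x - y| < Num.min p (x + n%:R).
  by near: y; apply: cvgr_dist_lt d0; exact: cvg_id.
rewrite lt_min ltr_distlC ltr_distlC => /andP[/andP[y1 y2] /andP[y3 y4]].
have [xy|yx|->//] := ltgtP x y.
- by apply/esym/F_locally_constant.
- by apply: F_locally_constant => //; lra.
Unshelve. all: by end_near.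
Qed.

End sampled_sums.
End vanishing.

(** * Lattice relations in L^2 *)

Section lattice_relation.
Context (R : realType).
Local Notation mu := (@lebesgue_measure R).
Local Notation aeS := (@filterS _ _ (ae_filter_ringOfSetsType mu)).
Implicit Types (p q r x t : R) (f : L2fun R) (l : int * int).

(** On a bounded interval [|g| <= g ^ 2 + 1], and both terms have finite integral. *)
Lemma integrable_itv_sqr (a b : R) (g : R -> R) : measurable_fun setT g ->
  (\int[mu]_t (g t ^+ 2)%:E < +oo)%E -> mu.-integrable `]a, b] (EFin \o g).
Proof.
move=> mg g2; apply/integrableP; split.
  exact/measurable_EFinP/measurable_funTS.
apply: (@le_lt_trans _ _ (\int[mu]_(t in `]a, b]) ((g t ^+ 2)%:E + 1%:E))%E).
  apply: ge0_le_integral => //.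
  - by apply/measurableT_comp => //; exact/measurable_EFinP/measurable_funTS.
  - apply: emeasurable_funD => //.
    exact/measurable_EFinP/measurable_funTS/measurable_funX.
  - move=> t _; rewrite /= -EFinD lee_fin -real_normK ?num_real//.
    by have := sqr_ge0 (`|g t| - 1); have := sqr_ge0 (`|g t|); nra.
rewrite ge0_integralD//; last 2 first.
- by move=> t _; rewrite lee_fin sqr_ge0.
- exact/measurable_EFinP/measurable_funTS/measurable_funX.
apply: lte_add_pinfty.
  apply: le_lt_trans g2; apply: ge0_subset_integral => //.
  - exact/measurable_EFinP/measurable_funX.
  - by move=> t _; rewrite lee_fin sqr_ge0.
rewrite integral_cst//= mul1e lebesgue_measure_itv/=.
by case: ifP => _; rewrite ?ltry// -EFinB ltry.
Qed.

(** The vanishing criterion is about real functions. Real and imaginary parts are additive and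
    dominated by the modulus, so each inherits the bound on sampled sums, with sampling step
    parameter [q^-1]. *)
Lemma ae0_of_relation (s : seq (int * int)) p q r (c : int * int -> R[i]) f :
  uniq s -> s != [::] -> (forall l, l \in s -> c l != 0) -> 0 < p -> q != 0 ->
  {ae mu, forall t : R, \sum_(l <- s)
    c l * cis (2 * pi * (l.2%:~R * q) * t) * f (t - zlin p r l) = 0} ->
  {ae mu, forall t, f t = 0}.
Proof.
move=> us s0 c0 p0 qn0 rel.
have [E /(_ p q r c f c0 p0 qn0 rel) EP] := integral_sampled_sum_le R us s0.
have /asboolP[mr mi fF] := valP f.
have part (P : R[i] -> R) : {morph P : x y / x + y} -> P 0 = 0 ->
    (forall z, P z ^+ 2 <= Normc.normc z ^+ 2) ->
    measurable_fun setT (fun t => P (f t)) -> {ae mu, forall t, P (f t) = 0}.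
  move=> PD P00 Pn mP.
  apply: (@ae0_of_sampled_sum_bound _ _ p q^-1 (E%:R * sqr_norm f) p0 mP).
  - move=> a b; apply: integrable_itv_sqr => //; apply: le_lt_trans fF.
    apply: ge0_le_integral => //.
    + by move=> t _; rewrite lee_fin sqr_ge0.
    + exact/measurable_EFinP/measurable_funX.
    + exact: measurable_sqr_normc_L2.
    + by move=> t _; rewrite lee_fin.
  - move=> x0 N J N0 JN; rewrite mulrAC; apply: le_trans (EP x0 N J N0 JN).
    apply: ge0_le_integral => //.
    + by move=> x _; rewrite lee_fin sqr_ge0.
    + apply/measurable_EFinP/measurable_funTS/measurable_funX.
      apply: measurable_sum => j; apply: (measurableT_comp mP).
      exact: measurable_shift.
    + apply: measurable_funTS.
      have := measurable_sqr_normc_L2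
        (sampled_fun f (fun=> 1) (- (q * N%:R)^-1) J).
      under eq_fun do rewrite sampled_funE.
      under eq_fun do under eq_bigr do rewrite mul1r mulrN.
      by [].
    + move=> x _; rewrite lee_fin; apply: le_trans (Pn _).
      rewrite (big_morph P PD P00) le_eqVlt; apply/orP; left; apply/eqP.
      by congr (_ ^+ 2); apply: eq_bigr => j _; rewrite invfM mulrA.
have R0 : {ae mu, forall t, complex.Re (f t) = 0}.
  apply: part mr => // [[? ?] [? ?]//|z].
  by rewrite Defs.sqr_normc lerDl sqr_ge0.
have I0 : {ae mu, forall t, complex.Im (f t) = 0}.
  apply: part mi => // [[? ?] [? ?]//|z].
  by rewrite Defs.sqr_normc lerDr sqr_ge0.
apply: (@filterS2 _ _ (ae_filter_ringOfSetsType mu)) R0 I0 => t.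
by case: (f t) => x y /= -> ->.
Qed.

Lemma chirp_subproof x f :
  (fun t => cis (x * t ^+ 2) * f t) \in @sqr_integrable_pred R.
Proof.
have /asboolP[mr mi fF] := valP f.
have mt : measurable_fun [set: R] (fun t => x * t ^+ 2).
  by apply: measurable_funM => //; exact: measurable_funX.
have mc : measurable_fun [set: R] (fun t => cos (x * t ^+ 2)).
  apply: measurableT_comp mt; apply: continuous_measurable_fun.
  exact: continuous_cos.
have ms : measurable_fun [set: R] (fun t => sin (x * t ^+ 2)).
  apply: measurableT_comp mt; apply: continuous_measurable_fun.
  exact: continuous_sin.
apply/asboolP; split.
- rewrite (_ : (fun t => _) = fun t => cos (x * t ^+ 2) * complex.Re (f t)
    - sin (x * t ^+ 2) * complex.Im (f t)).
    by apply: measurable_funB; exact: measurable_funM.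
  by apply/funext => t; case: (f t).
- rewrite (_ : (fun t => _) = fun t => cos (x * t ^+ 2) * complex.Im (f t)
    + sin (x * t ^+ 2) * complex.Re (f t)).
    by apply: measurable_funD; exact: measurable_funM.
  by apply/funext => t; case: (f t).
- apply: le_lt_trans fF; rewrite le_eqVlt; apply/orP; left; apply/eqP.
  by apply: eq_integral => t _; rewrite Normc.normcM normc_cis mul1r.
Qed.

Definition chirp_fun x f : L2fun R := MkL2fun (chirp_subproof x f).

Definition zcomb (u v : 'rV[R]_2) l : 'rV[R]_2 := u *~ l.1 + v *~ l.2.

Lemma zcomb_coord u v l i : zcomb u v l 0 i = zlin (u 0 i) (v 0 i) l.
Proof.
by rewrite /zcomb /zlin -[u *~ _]scaler_int -[v *~ _]scaler_int !mxE.
Qed.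

(* The chirp [f (t) exp (- i pi (u1 / u0) t ^ 2)] shears the time-frequency
   plane, moving u = (u0, u1) to (u0, 0). *)
Lemma ae0_of_lattice_relation (s : seq (int * int)) (u v : 'rV[R]_2)
    (c : int * int -> R[i]) f :
  uniq s -> s != [::] -> (forall l, l \in s -> c l != 0) ->
  0 < u 0 0 -> u 0 0 * v 0 1 != u 0 1 * v 0 0 ->
  {ae mu, forall t : R, \sum_(l <- s)
    c l * (cis (2 * pi * zcomb u v l 0 1 * t) * f (t - zcomb u v l 0 0)) = 0} ->
  {ae mu, forall t, f t = 0}.
Proof.
move=> us s0 c0 u0 uv rel.
have un0 : u 0 0 != 0 by rewrite gt_eqF.
(* [q] is the frequency of [v] after the shear; [u 0 0 * q] is the determinant of [u] and [v],
   whence [q != 0]. *)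
pose k := pi * u 0 1 / u 0 0; pose q := v 0 1 - u 0 1 / u 0 0 * v 0 0.
have qn0 : q != 0.
  apply: contra uv => /eqP q0; rewrite -subr_eq0; apply/eqP.
  by rewrite -(mulr0 (u 0 0)) -q0 /q; field.
suff H : {ae mu, forall t, chirp_fun (- k) f t = 0}.
  apply: aeS H => t /eqP.
  rewrite [_ t]/(cis (- k * t ^+ 2) * f t) mulf_eq0 (negbTE (cis_neq0 _)).
  by move=> /eqP.
apply: (ae0_of_relation (p := u 0 0) (q := q) (r := v 0 0)
  (c := fun l => c l * cis (k * zlin (u 0 0) (v 0 0) l ^+ 2)) us s0) => //.
  by move=> l ls; rewrite mulf_neq0 ?c0 ?cis_neq0.
apply: aeS rel => t relt.
apply: (mulfI (cis_neq0 (k * t ^+ 2))); rewrite mulr0 -[RHS]relt mulr_sumr.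
apply: eq_bigr => l _; rewrite !zcomb_coord.
set x := zlin (u 0 0) (v 0 0) l.
rewrite (_ : chirp_fun _ _ _ = cis (- k * (t - x) ^+ 2) * f (t - x))//.
(* Since [k (t ^ 2 + x ^ 2 - (t - x) ^ 2) = 2 k t x], the chirps supply the frequency that the shear
   removed. The factor in [x ^ 2] is constant in [t] and goes into the coefficients. *)
have phase : cis (2 * pi * zlin (u 0 1) (v 0 1) l * t) = cis (k * t ^+ 2) *
    (cis (k * x ^+ 2) * cis (2 * pi * (l.2%:~R * q) * t) *
     cis (- k * (t - x) ^+ 2)).
  by rewrite -!cisD; congr cis; rewrite /k /q /x /zlin; field.
by rewrite phase; ring.
Qed.

Lemma tfshift_pi (z : 'rV[R]_2) f : tfshift z (\pi_(L2 R) f)%qT =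
  (\pi_(L2 R) (modulation_fun (z 0 1) (translation_fun (z 0 0) f)))%qT.
Proof. by rewrite /tfshift translation_pi modulation_pi. Qed.

Lemma pi_L2_0 : (\pi_(L2 R) 0)%qT = 0.
Proof. by rewrite -(scale0r 0) pi_L2Z scale0r. Qed.

Lemma sum_tfshift_eq0 (s : seq 'rV[R]_2) (c : 'rV[R]_2 -> R[i]) f :
  \sum_(z <- s) c z *: tfshift z (\pi_(L2 R) f)%qT = 0 ->
  {ae mu, forall t : R, \sum_(z <- s)
    c z * (cis (2 * pi * z 0 1 * t) * f (t - z 0 0)) = 0}.
Proof.
pose g : L2fun R := \sum_(z <- s)
  c z *: modulation_fun (z 0 1) (translation_fun (z 0 0) f).
have -> : \sum_(z <- s) c z *: tfshift z (\pi_(L2 R) f)%qT =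
    (\pi_(L2 R) g)%qT.
  rewrite /g; elim: (s) => [|z s' IH].
    by rewrite !big_nil pi_L2_0.
  by rewrite !big_cons IH pi_L2D pi_L2Z tfshift_pi.
move=> g0; have /eqP/L2_eqP : (\pi_(L2 R) g)%qT = (\pi_(L2 R) 0)%qT.
  by rewrite g0 pi_L2_0.
apply: aeS => t; rewrite /g L2fun_sumE => gt.
by apply: etrans gt; apply: eq_bigr.
Qed.

End lattice_relation.

(** * Linear independence along a full-rank lattice *)

Section lattice_independence.
Context (R : realType).
Implicit Types (u v : 'rV[R]_2).

Lemma rV2P u v : u 0 0 = v 0 0 -> u 0 1 = v 0 1 -> u = v.
Proof.
move=> e0 e1; apply/rowP => -[[|[|//]] i2].
  by rewrite (_ : Ordinal i2 = 0)//; exact: val_inj.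
by rewrite (_ : Ordinal i2 = 1)//; exact: val_inj.
Qed.

Lemma free2P u v : free [:: u; v] -> u 0 0 * v 0 1 != u 0 1 * v 0 0.
Proof.
rewrite free_cons seq1_free span_seq1 => /andP[uv v0].
apply: contra uv => /eqP e; apply/vlineP.
have [v00|v00] := eqVneq (v 0 0) 0; last first.
  exists (u 0 0 / v 0 0); apply: rV2P; rewrite mxE ?divfK//.
  by rewrite mulrAC e mulfK.
have v01 : v 0 1 != 0.
  by apply: contra v0 => /eqP v01; apply/eqP/rV2P; rewrite mxE.
exists (u 0 1 / v 0 1); apply: rV2P; rewrite mxE ?divfK//.
by rewrite mulrAC -e mulfK.
Qed.

Lemma free2_scale (k : R) u v : k != 0 -> free [:: u; v] ->
  free [:: k *: u; k *: v].
Proof.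
move=> k0; rewrite !free_cons !span_nil !memv0 !nil_free !andbT !span_seq1.
move=> /andP[uv v0]; rewrite scaler_eq0 negb_or k0 v0 !andbT.
apply: contra uv => /vlineP[x e]; apply/vlineP; exists x.
by apply: (scalerI k0); rewrite e !scalerA mulrC.
Qed.

Lemma zspanP u v z : zspan u v z <-> exists l, z = zcomb u v l.
Proof. by split=> [[m [n ->]]|[l ->]]; [exists (m, n)|exists l.1, l.2]. Qed.

(** A vertical [u] is exchanged with [v], which is then not vertical because the determinant is
    nonzero; a negative first coordinate is cured by a change of sign. *)
Lemma zspan_pos_basis u v : u 0 0 * v 0 1 != u 0 1 * v 0 0 ->
  exists u' v', [/\ 0 < u' 0 0, u' 0 0 * v' 0 1 != u' 0 1 * v' 0 0 &
    zspan u v `<=` zspan u' v'].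
Proof.
have pos (x y : 'rV[R]_2) : x 0 0 != 0 -> x 0 0 * y 0 1 != x 0 1 * y 0 0 ->
    exists u' v', [/\ 0 < u' 0 0, u' 0 0 * v' 0 1 != u' 0 1 * v' 0 0 &
    zspan x y `<=` zspan u' v'].
  case: (ltgtP (x 0 0) 0) => // x0 _ xy; last by exists x, y; split.
  exists (- x), y.
  split; rewrite ?mxE ?oppr_gt0 ?mulNr ?eqr_opp//.
  by move=> _ [m [n ->]]; exists (- m), n; rewrite mulNrz mulrNz opprK.
have [u0 uv|u0] := eqVneq (u 0 0) 0; last exact: pos.
have [||u' [v' [u'0 u'v' s]]] := pos v u.
- by apply: contra uv => /eqP ->; rewrite u0 mul0r mulr0.
- by rewrite eq_sym mulrC [eqbRHS]mulrC.
by exists u', v'; split=> // _ [m [n ->]]; apply: s; exists n, m; rewrite addrC.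
Qed.

Lemma lattice_lin_indep (L : set 'rV[R]_2) (f : L2 R) :
  full_rank_lattice L -> f != 0 -> lin_indep L (fun z => tfshift z f).
Proof.
move=> [u0 [v0 [/free2P/zspan_pos_basis[u [v [up uv s0]] ->]]]].
elim/quotW: f => f f0 s c us sL sum0 i si.
have [//|ci] := eqVneq (c i) 0; exfalso; move/negP: f0; apply.
have /choice[k kP] (z : 'rV[R]_2) : exists l, z \in s -> zcomb u v l = z.
  have [zs|zs] := boolP (z \in s); last by exists 0.
  by have /s0/zspanP[l ->] := sL z zs; exists l.
(* The relation lemma wants nonzero coefficients and indices in Z^2: zero terms are dropped and the
   others replaced by their coordinates [k z]. The term [i] survives, so [s'] is not empty. *)
pose s' := [seq k z | z <- s & c z != 0].
have ks' l : l \in s' -> c (zcomb u v l) != 0.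
  by move=> /mapP[z + ->]; rewrite mem_filter => /andP[cz zs]; rewrite kP.
have us' : uniq s'.
  rewrite map_inj_in_uniq ?filter_uniq// => x y.
  rewrite !mem_filter => /andP[_ xs] /andP[_ ys] e.
  by rewrite -(kP x xs) e kP.
have s'0 : s' != [::].
  have : k i \in s' by rewrite map_f// mem_filter ci.
  by case: s' {ks' us'}.
have f0 : {ae lebesgue_measure, forall t, f t = 0}.
  apply: (ae0_of_lattice_relation us' s'0 ks' up uv).
  have := sum_tfshift_eq0 sum0.
  apply: (@filterS _ _ (ae_filter_ringOfSetsType _)) => t e.
  rewrite -[RHS]e big_map big_filter [RHS](bigID (fun z => c z == 0))/=.
  rewrite [X in _ = X + _]big1 ?add0r; last by move=> z /eqP ->; rewrite mul0r.
  rewrite big_seq_cond [RHS]big_seq_cond.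
  by apply: eq_bigr => z /andP[zs _]; rewrite kP.
rewrite -pi_L2_0; exact/L2_eqP.
Qed.

End lattice_independence.

(** * Rational coordinates and the finer lattice *)

Theorem theorem4p1 (R : realType) (a b nu : 'rV[R]_2) (r s : R)
    (hab : free [:: a; b]) (hnu : nu = r *: a + s *: b)
    (hr : rational r) (hs : rational s) :
  let Lambda := [set 0; a; b; nu] : set 'rV[R]_2 in
  (exists L : set 'rV[R]_2,
     [/\ full_rank_lattice L, zspan a b `<=` L & Lambda `<=` L]) /\
  (forall f : L2 R, f != 0 ->
     lin_indep Lambda (fun lam : 'rV[R]_2 => tfshift lam f)).
Proof.
move=> Lambda.
have [L [LL abL LamL]] : exists L : set 'rV[R]_2,
    [/\ full_rank_lattice L, zspan a b `<=` L & Lambda `<=` L].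
  case: hr => r' _ r'E; case: hs => s' _ s'E.
  (* A common denominator of [r] and [s]; dividing [a] and [b] by it gives a basis of the finer
     lattice. *)
  pose d : R := (denq r' * denq s')%:~R.
  have d0 : d != 0 by rewrite intr_eq0 mulf_neq0 ?denq_neq0.
  have dr0 : (denq r')%:~R != 0 :> R by rewrite intr_eq0 denq_neq0.
  have ds0 : (denq s')%:~R != 0 :> R by rewrite intr_eq0 denq_neq0.
  have zscale (m n : int) (x y : R) : x * d = m%:~R -> y * d = n%:~R ->
      zspan (d^-1 *: a) (d^-1 *: b) (x *: a + y *: b).
    move=> xm yn; exists m, n.
    rewrite -[_ *~ m]scaler_int -[_ *~ n]scaler_int !scalerA -xm -yn.
    by rewrite !mulfK.
  have abL : zspan a b `<=` zspan (d^-1 *: a) (d^-1 *: b).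
    move=> _ [m [n ->]]; rewrite -[_ *~ m]scaler_int -[_ *~ n]scaler_int.
    by apply: zscale; rewrite /d -intrM.
  exists (zspan (d^-1 *: a) (d^-1 *: b)); split=> //.
    exists (d^-1 *: a), (d^-1 *: b); split=> //.
    by rewrite free2_scale ?invr_eq0.
  move=> _ [[[->|->]|->]|->].
  - by apply: abL; exists 0, 0; rewrite !mulr0z addr0.
  - by apply: abL; exists 1, 0; rewrite mulr0z addr0.
  - by apply: abL; exists 0, 1; rewrite mulr0z add0r.
  rewrite hnu; apply: (zscale (numq r' * denq s') (numq s' * denq r')).
    by rewrite -r'E /d /ratr !intrM; field.
  by rewrite -s'E /d /ratr !intrM; field.
split; first by exists L.
move=> f f0 t c ut tL; apply: (lattice_lin_indep LL f0) ut _ => x /tL.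
exact: LamL.
Qed.
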